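(* Let $q=ef+1$ be a prime power with $q\equiv1\pmod4$, $e$ even and $f=2$, and let ${C_0^2}'=\{C_0^e,C_2^e,\ldots,C_{e-2}^e\}$ (a family of $\frac{q-1}{4}$ sets of size $2$). Then (i) when $q\equiv1\pmod8$, ${C_0^2}'$ is a $(q,\frac{q-1}{4},2,1,0)$-disjoint partial difference family and a $(q,\frac{q-1}{4},2,\frac{q-9}{4},\frac{q-1}{4})$-external partial difference family; (ii) when $q\equiv5\pmod8$, ${C_0^2}'$ is a $(q,\frac{q-1}{4},2,0,1)$-disjoint partial difference family and a $(q,\frac{q-1}{4},2,\frac{q-5}{4})$-external difference family.
   Context: $G=(GF(q),+)$, $G^*=G\setminus\{0\}$; $\alpha$ a primitive element; $C_i^d=\alpha^i\langle\alpha^d\rangle$ for $d\mid q-1$. $\Delta(D)$ is the multiset $\{x-y:x,y\in D,x\neq y\}$, $\Delta(D_1,D_2)$ the multiset $\{x-y:x\in D_1,y\in D_2\}$, $\lambda A$ is $\lambda$ copies of each element of $A$. For a family of $m$ disjoint $k$-subsets $D_i$ of $G^*$ with union $S$: $(q,m,k,\lambda,\mu)$-disjoint (resp. external) partial difference family means $\bigcup_i\Delta(D_i)$ (resp. $\bigcup_{i\neq j}\Delta(D_i,D_j)$) equals $\lambda S+\mu(G^*\setminus S)$; $(q,m,k,\lambda)$-external difference family means $\bigcup_{i\neq j}\Delta(D_i,D_j)=\lambda G^*$. *)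

(* Defs.v *)
From HB Require Import structures.
From mathcomp Require Import all_boot all_order all_algebra all_fingroup all_field.

Set Implicit Arguments.
Unset Strict Implicit.
Unset Printing Implicit Defensive.

Import GRing.Theory.
Local Open Scope ring_scope.

(* Finite multisets of elements of G are represented by sequences up to       *)
(* perm_eq; multiset union (with multiplicities added) is concatenation.      *)
Section DifferenceFamilies.

Variable G : finZmodType.
Implicit Types (A B : {set G}) (D : {set {set G}}).

Definition Delta A : seq G := [seq x - y | x <- enum A, y <- enum (A :\ x)].

Definition Delta2 A B : seq G := [seq x - y | x <- enum A, y <- enum B].

Definition copies (lambda : nat) A : seq G := flatten (nseq lambda (enum A)).

Definition internal_differences D : seq G :=
  \big[cat/[::]]_(A in D) Delta A.

Definition external_differences D : seq G :=
  \big[cat/[::]]_(A in D) \big[cat/[::]]_(B in D | B != A) Delta2 A B.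

Definition disjoint_family (n m k : nat) D : Prop :=
  [/\ #|G| = n, #|D| = m, {in D, forall A, #|A| = k},
      trivIset D & cover D \subset [set~ 0]].

Definition disjoint_partial_difference_family (n m k lambda mu : nat) D : Prop :=
  disjoint_family n m k D /\
  perm_eq (internal_differences D)
    (copies lambda (cover D) ++ copies mu ([set~ 0] :\: cover D)).

Definition external_partial_difference_family (n m k lambda mu : nat) D : Prop :=
  disjoint_family n m k D /\
  perm_eq (external_differences D)
    (copies lambda (cover D) ++ copies mu ([set~ 0] :\: cover D)).

Definition external_difference_family (n m k lambda : nat) D : Prop :=
  disjoint_family n m k D /\
  perm_eq (external_differences D) (copies lambda [set~ 0]).

End DifferenceFamilies.

Section Cyclotomy.

Variable F : finFieldType.

Definition primitive_element (alpha : F) : bool :=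
  #|F|.-1.-primitive_root alpha.

(* The coset alpha^i <alpha^d>. The exponents j < #|F| - 1 exhaust the        *)
(* subgroup <alpha^d>, since alpha^(#|F| - 1) = 1 for nonzero alpha.          *)
Definition cyclotomic_class (alpha : F) (d i : nat) : {set F} :=
  [set alpha ^+ i * (alpha ^+ d) ^+ j | j : 'I_#|F|.-1].

(* {C_0^e, C_2^e, ..., C_(e-2)^e} for even e.                                 *)
Definition even_classes (alpha : F) (e : nat) : {set {set F}} :=
  [set cyclotomic_class alpha e (i.*2) | i : 'I_(e./2)].

End Cyclotomy.

(* Main.v *)
(* As alpha^e = -1, the family consists of the pairs {x, -x} with x a nonzero
   square, so its union Q is the set of nonzero squares and its internal
   differences are the elements of 2Q.  Since 2i = (1 + i)^2 for
   i = alpha^(e/2), the set 2Q is Q or its complement in F^* according to the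
   parity of e/2, i.e. to q modulo 8.  Internal and external differences
   together are all the nonzero differences of two elements of Q; their
   multiplicities follow from the equation u^2 - v^2 = z having q - 1
   solutions for every z <> 0. *)
Require Import Defs.
From HB Require Import structures.
From mathcomp Require Import all_boot all_order all_algebra all_fingroup all_field.
From mathcomp Require Import zify ring.

Set Implicit Arguments.
Unset Strict Implicit.
Unset Printing Implicit Defensive.

Import GRing.Theory.

(** * Counting occurrences in concatenations *)

Lemma sum_eq_mem (T : finType) (A : {set T}) (y : T) :
  \sum_(x in A) (x == y) = (y \in A).
Proof.
have [Ay | nAy] := boolP (y \in A).
  rewrite (big_setD1 y) //= eqxx big1 // => x.
  by rewrite !inE => /andP[/negPf->].
by apply: big1 => x Ax; case: eqP => // eq_xy; rewrite eq_xy (negPf nAy) in Ax.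
Qed.

Lemma count_bigcat (T : Type) (I : finType) (P : pred I) (p : pred T)
    (s : I -> seq T) :
  count p (\big[cat/[::]]_(i | P i) s i) = \sum_(i | P i) count p (s i).
Proof. by apply: (big_morph (count p)) => // x y; rewrite count_cat. Qed.

Lemma count_allpairs_dep (S T U : Type) (p : pred U) (h : S -> T -> U)
    (s : seq S) (t : S -> seq T) :
  count p [seq h x y | x <- s, y <- t x]
    = \sum_(x <- s) \sum_(y <- t x) p (h x y).
Proof.
rewrite count_flatten sumnE !big_map; apply: eq_bigr => x _.
by rewrite count_map -sum1_count big_mkcond.
Qed.

(** * Multiplicities of internal and external differences *)

Section DifferenceCounts.

Variable G : finZmodType.
Implicit Types (A B : {set G}) (D : {set {set G}}) (z : G).

Lemma count_Delta2 A B z :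
  count_mem z (Delta2 A B) = \sum_(x in A) ((x - z)%R \in B).
Proof.
rewrite /Delta2 count_allpairs_dep big_enum; apply: eq_bigr => x _.
rewrite big_enum /= -sum_eq_mem; apply: eq_bigr => y _.
by rewrite subr_eq addrC -subr_eq eq_sym.
Qed.

Lemma count_Delta A z : z != 0%R ->
  count_mem z (Delta A) = \sum_(x in A) ((x - z)%R \in A).
Proof.
move=> nz_z; rewrite -count_Delta2 /Delta /Delta2 !count_allpairs_dep !big_enum.
apply: eq_bigr => x Ax; rewrite !big_enum /= [RHS](big_setD1 x) //=.
by rewrite subrr [0%R == z]eq_sym (negPf nz_z).
Qed.

Lemma count_copies n A z : count_mem z (copies n A) = n * (z \in A).
Proof.
rewrite /copies count_flatten map_nseq sumn_nseq mulnC; congr (_ * _).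
by rewrite count_uniq_mem ?enum_uniq // mem_enum.
Qed.

Lemma count0_internal_differences D :
  count_mem 0%R (internal_differences D) = 0.
Proof.
rewrite /internal_differences count_bigcat; apply: big1 => A _.
rewrite /Delta count_allpairs_dep big_enum; apply: big1 => x _.
rewrite big_enum; apply: big1 => y; rewrite !inE /= subr_eq0 eq_sym.
by case/andP=> /negPf->.
Qed.

Lemma count0_external_differences D :
  trivIset D -> count_mem 0%R (external_differences D) = 0.
Proof.
move=> /trivIsetP tD; rewrite /external_differences count_bigcat.
apply: big1 => A DA; rewrite count_bigcat; apply: big1 => B /andP[DB neqBA].
rewrite count_Delta2; apply: big1 => x Ax; rewrite subr0.
by rewrite (disjointFr (tD A B DA DB _)) // eq_sym.
Qed.

(** For each block [A], its internal count is exactly the term [B = A] missing from the external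
    sum, so together all ordered pairs of blocks are covered. *)
Lemma count_internal_external D z : trivIset D -> z != 0%R ->
  count_mem z (internal_differences D) + count_mem z (external_differences D)
    = \sum_(x in cover D) ((x - z)%R \in cover D).
Proof.
move=> tD nz_z; rewrite /internal_differences /external_differences.
rewrite !count_bigcat -big_split /= big_trivIset //=.
apply: eq_bigr => A DA; rewrite count_Delta // count_bigcat.
under [X in _ + X]eq_bigr => B _ do rewrite count_Delta2.
rewrite -(bigD1 (P := mem D) A
  (F := fun B => \sum_(x in A) ((x - z)%R \in B))) //=.
rewrite exchange_big /=; apply: eq_bigr => x _.
rewrite -sum_eq_mem big_trivIset //=.
by apply: eq_bigr => B _; rewrite sum_eq_mem.
Qed.

(* In [{x, - x}] the difference [x - y] is nonzero only for [y = - x]. *)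
Lemma count_internal_pairs D z :
    trivIset D ->
    {in D, forall A : {set G}, {in A, forall x, A = [set x; (- x)%R]}} ->
  z != 0%R ->
  count_mem z (internal_differences D) = \sum_(x in cover D) (z == (x *+ 2)%R).
Proof.
move=> tD pairD nz_z; rewrite /internal_differences count_bigcat.
rewrite big_trivIset //=; apply: eq_bigr => A DA; rewrite count_Delta //.
apply: eq_bigr => x Ax; congr nat_of_bool.
rewrite {1}(pairD A DA x Ax) !inE -subr_eq0 addrAC subrr add0r oppr_eq0.
by rewrite (negPf nz_z) /= -subr_eq0 opprK addrAC -mulr2n subr_eq0 eq_sym.
Qed.

End DifferenceCounts.

(** * Differences of nonzero squares in odd characteristic *)

Section NonzeroSquares.

Variable F : finFieldType.
Hypothesis odd_charF : (2%:R != 0 :> F)%R.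
Local Open Scope ring_scope.

Definition nonzero_squares : {set F} := [set w ^+ 2 | w in [set~ 0]].

Lemma nonzero_squareP (x : F) :
  reflect (exists2 w : F, w != 0 & x = w ^+ 2) (x \in nonzero_squares).
Proof.
by apply: (iffP imsetP) => -[w]; rewrite ?inE => w0 ->; exists w; rewrite ?inE.
Qed.

Lemma eq_opp0 (x : F) : (x == - x) = (x == 0).
Proof. by rewrite -addr_eq0 -mulr2n -mulr_natl mulf_eq0 (negPf odd_charF). Qed.

(** Over a nonzero square [w ^+ 2], the fibre of squaring is [[set w; - w]], which has two elements
    since [2 != 0]. *)
Lemma sum_squares (g : F -> nat) :
  (\sum_(u : F) g (u ^+ 2)%R = g 0%R + (\sum_(x in nonzero_squares) g x).*2)%N.
Proof.
rewrite (bigD1 0) //= expr0n /=; congr (_ + _)%N.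
rewrite (partition_big (fun u => u ^+ 2) (mem nonzero_squares)) /=; last first.
  by move=> u nz_u; apply/nonzero_squareP; exists u.
rewrite -muln2 big_distrl /=; apply: eq_bigr => x /nonzero_squareP[w nz_w ->].
rewrite (eq_bigr (fun=> g (w ^+ 2))); last by move=> u /andP[_ /eqP->].
rewrite sum_nat_const mulnC; congr (_ * _)%N.
transitivity #|[set w; - w]|; last by rewrite cards2 eq_opp0 nz_w.
apply: eq_card => u; rewrite !inE unfold_in /= eqf_sqr.
have [-> | _ ] := eqVneq u w; first by rewrite nz_w.
by have [-> | _ ] := eqVneq u (- w); rewrite ?oppr_eq0 ?nz_w ?andbF.
Qed.

(* Substitute [s = u - v] and [t = u + v]: the solutions are [t = z / s]. *)
Lemma sum_sub_squares (z : F) : z != 0 ->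
  (\sum_(u : F) \sum_(v : F) (u ^+ 2 - v ^+ 2 == z)%R = #|F|.-1)%N.
Proof.
move=> nz_z.
(* With [v = u - s], the factor [u + v] becomes [u *+ 2 - s]; each nonzero [s] then allows exactly
   one [u], and [s = 0] none. *)
transitivity (\sum_(s : F) \sum_(u : F) (s * (u *+ 2 - s) == z)%R)%N.
  rewrite [RHS]exchange_big /=; apply: eq_bigr => u _.
  rewrite (reindex_inj (h := fun s => u - s)) /=; last first.
    by move=> s t /addrI/oppr_inj.
  by apply: eq_bigr => s _; congr (nat_of_bool (_ == _)); ring.
rewrite (bigD1 0) //= big1 => [|u _]; last by rewrite mul0r eq_sym (negPf nz_z).
rewrite add0n (eq_bigr (fun=> 1%N)) => [|s nz_s].
  by rewrite sum1_card cardC1.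
rewrite (bigD1 ((z / s + s) / 2%:R)) //= big1 => [|u neq_u].
  suff -> : s * ((z / s + s) / 2%:R *+ 2 - s) = z by rewrite eqxx.
  by rewrite -mulr_natr divfK // addrK mulrC divfK.
case: eqP => // Dz; case/eqP: neq_u.
by rewrite -Dz mulrAC mulfV // mul1r subrK -[u *+ 2]mulr_natr mulfK.
Qed.

(** Among the [#|F|.-1] solutions of [u ^+ 2 - v ^+ 2 = z], each pair of nonzero squares comes from
    four choices of signs. Those with [v = 0] or [u = 0] number two each if [z], resp. [- z], is a
    square, and none otherwise; the two conditions agree as -1 is a square. *)
Lemma sum_nonzero_squares_shift (z : F) : z != 0 ->
    -1 \in nonzero_squares ->
  (4 * (\sum_(x in nonzero_squares) (x - z \in nonzero_squares)%R)
    + 4 * (z \in nonzero_squares) = #|F|.-1)%N.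
Proof.
move=> nz_z /nonzero_squareP[i nz_i Di]; rewrite -(sum_sub_squares nz_z).
have sumE x : (\sum_(v : F) (x - v ^+ 2 == z)%R
    = (x == z)%R + (x - z \in nonzero_squares)%R.*2)%N.
  rewrite (sum_squares (fun y => (x - y == z)%R : nat)) subr0 -sum_eq_mem.
  congr (_ + _.*2)%N; apply: eq_bigr => y _.
  by rewrite subr_eq addrC -subr_eq eq_sym.
under [RHS]eq_bigr => u _ do rewrite sumE.
rewrite (sum_squares (fun x => (x == z) + (x - z \in nonzero_squares)%R.*2)%N).
rewrite big_split /= sum_eq_mem sub0r eq_sym (negPf nz_z).
(* Multiplying by [i] turns a square root of either of [z], [- z] into one of the other. *)
have -> : (- z \in nonzero_squares) = (z \in nonzero_squares).
  apply/nonzero_squareP/nonzero_squareP => -[w nz_w Dz]; exists (i * w);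
    rewrite ?mulf_neq0 // exprMn -Di -?Dz ?mulN1r ?opprK //.
rewrite -(big_morph double doubleD (erefl 0.*2)).
lia.
Qed.

End NonzeroSquares.

(** * The family of even cyclotomic classes *)

Section EvenClasses.

Variables (F : finFieldType) (alpha : F) (e : nat).
Hypotheses (cardF : #|F| = e * 2 + 1) (alpha_prim : primitive_element alpha).
Hypothesis e_even : ~~ odd e.
Local Open Scope ring_scope.

Local Notation Q := (nonzero_squares F).
Local Notation D := (even_classes alpha e).

Let e_gt0 : (0 < e)%N.
Proof. by have := finNzRing_gt1 F; rewrite cardF; lia. Qed.

Let e_half : e = (e./2 * 2)%N.
Proof. by rewrite muln2 even_halfK. Qed.

Let card1F : #|F|.-1 = (e * 2)%N.
Proof. by rewrite cardF; lia. Qed.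

Let primE : (e * 2).-primitive_root alpha.
Proof. by rewrite -card1F. Qed.

Lemma primitive_element_neq0 : alpha != 0.
Proof. by rewrite (prim_root_eq0 primE); lia. Qed.

Lemma primitive_element_log (x : F) : x != 0 -> exists k, x = alpha ^+ k.
Proof.
move=> nz_x; have /(prim_rootP primE)[i ->] : x ^+ (e * 2) = 1.
  by apply: (mulfI nz_x); rewrite mulr1 -exprS -card1F prednK ?expf_card //;
     rewrite cardF; lia.
by exists i.
Qed.

Lemma primitive_element_half : alpha ^+ e = -1.
Proof.
have: alpha ^+ e != 1.
  by rewrite -(prim_order_dvd primE); apply/negP => /(dvdn_leq e_gt0); lia.
have: (alpha ^+ e) ^+ 2 == 1 by rewrite -exprM prim_expr_order.
by rewrite sqrf_eq1 => /orP[/eqP->|/eqP//]; rewrite eqxx.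
Qed.

Lemma primitive_element_odd_char : 2%:R != 0 :> F.
Proof.
apply/eqP => two0; have := primitive_element_half.
have -> : -1 = 1 :> F by apply/eqP; rewrite eq_sym -addr_eq0 -mulr2n two0.
move/eqP; rewrite -(prim_order_dvd primE) => /(dvdn_leq e_gt0); lia.
Qed.

(** Exponents of [alpha] matter only modulo the even number [e * 2], so their parity is well
    defined. *)
Lemma exp_nonzero_square k : (alpha ^+ k \in Q) = ~~ odd k.
Proof.
apply/nonzero_squareP/idP => [[w nz_w Dw] | even_k].
  have [m Dm] := primitive_element_log nz_w.
  move/eqP: Dw; rewrite Dm -exprM (eq_prim_root_expr primE) => /eqP/(congr1 odd).
  by rewrite !odd_mod ?oddM ?andbF // => ->.
exists (alpha ^+ k./2); first by rewrite expf_neq0 // primitive_element_neq0.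
by rewrite -exprM muln2 even_halfK.
Qed.

Lemma oppr1_nonzero_square : -1 \in Q.
Proof. by rewrite -primitive_element_half exp_nonzero_square. Qed.

(* With [i = alpha ^+ e./2] a square root of -1, [2 i = (1 + i) ^+ 2]. *)
Lemma double_nonzero_square (x : F) : x != 0 ->
  (x *+ 2 \in Q) = (x \in Q) (+) odd e./2.
Proof.
move=> nz_x; set i := alpha ^+ e./2.
have Di : i ^+ 2 = -1 by rewrite -exprM -e_half primitive_element_half.
have nz_1i : 1 + i != 0.
  apply: contra primitive_element_odd_char; rewrite addrC addr_eq0 => /eqP i1.
  by move/eqP: Di; rewrite i1 sqrrN expr1n -addr_eq0 -mulr2n.
have [t Dt] := primitive_element_log primitive_element_odd_char.
have [k ->] := primitive_element_log nz_x.
(* This power is [2 i], a square, so the exponent [t] of 2 has the parity of [e./2]. *)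
have: alpha ^+ (t + e./2) \in Q.
  apply/nonzero_squareP; exists (1 + i); rewrite // exprD -Dt -/i.
  by rewrite sqrrD Di; ring.
rewrite -mulr_natl Dt -exprD !exp_nonzero_square !oddD.
by case: odd; case: odd; case: odd.
Qed.

(** The powers of [alpha ^+ e = -1] are 1 and -1, already reached at the exponents 0 and 1. *)
Lemma cyclotomic_class_pair i :
  cyclotomic_class alpha e i = [set alpha ^+ i; - alpha ^+ i].
Proof.
apply/setP => x; rewrite !inE /cyclotomic_class primitive_element_half.
apply/imsetP/orP => [[j _ ->] | ].
  by rewrite -signr_odd; case: odd; rewrite ?mulr1 ?mulrN1 eqxx; [right | left].
have lt0 : (0 < #|F|.-1)%N by rewrite card1F; lia.
have lt1 : (1 < #|F|.-1)%N by rewrite card1F; lia.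
case=> /eqP->; [exists (Ordinal lt0) | exists (Ordinal lt1)] => //.
  by rewrite mulr1.
by rewrite mulrN1.
Qed.

Lemma even_class_pair :
  {in D, forall A : {set F}, {in A, forall x, A = [set x; - x]}}.
Proof.
move=> A /imsetP[i _ ->] x; rewrite cyclotomic_class_pair !inE.
by case/orP=> /eqP->; rewrite // opprK setUC.
Qed.

Lemma cover_even_classes : cover D = Q.
Proof.
apply/setP => x; apply/bigcupP/idP => [[A /imsetP[i _ ->]] | ].
  rewrite cyclotomic_class_pair !inE => /orP[]/eqP->.
    by rewrite exp_nonzero_square odd_double.
  rewrite -mulN1r -primitive_element_half -exprD exp_nonzero_square.
  by rewrite oddD odd_double addbF.
case/nonzero_squareP=> w nz_w ->{x}; have [k ->] := primitive_element_log nz_w.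
have lt_i : (k %% e./2 < e./2)%N by rewrite ltn_mod; lia.
exists (cyclotomic_class alpha e (k %% e./2).*2).
  by apply/imsetP; exists (Ordinal lt_i).
(* Dividing [k] by [e./2] writes [alpha ^+ (k * 2)] as a sign, a power of [alpha ^+ e], times the
   representative of an even class. *)
have Dk : (k * 2 = e * (k %/ e./2) + (k %% e./2).*2)%N.
  by rewrite {1}(divn_eq k e./2) {4}e_half -muln2; ring.
rewrite cyclotomic_class_pair !inE -exprM Dk.
rewrite exprD exprM primitive_element_half -signr_odd.
by case: odd; rewrite ?expr1 ?expr0 ?mul1r ?mulN1r eqxx ?orbT.
Qed.

Lemma even_classes_disjoint_family : disjoint_family (e * 2 + 1) e./2 2 D.
Proof.
split=> //.
(* The exponents [i.*2], [j.*2] and [e + j.*2] all lie below the order [e * 2], and [i.*2 < e] rules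
   out the last. *)
- rewrite card_imset ?card_ord // => i j /setP/(_ (alpha ^+ i.*2)).
  rewrite !cyclotomic_class_pair !inE eqxx /= => /esym/orP eq_ij; apply: ord_inj.
  have [lti ltj] := (ltn_ord i, ltn_ord j).
  case: eq_ij; last rewrite -mulN1r -primitive_element_half -exprD.
    by rewrite (eq_prim_root_expr primE) !modn_small => [/eqP||]; lia.
  by rewrite (eq_prim_root_expr primE) !modn_small => [/eqP||]; lia.
- move=> A /imsetP[i _ ->]; rewrite cyclotomic_class_pair cards2 eq_opp0.
    by rewrite expf_neq0 // primitive_element_neq0.
  exact: primitive_element_odd_char.
(* A common element [x] forces both blocks to be [[set x; - x]]. *)
- apply/trivIsetP => A B DA DB; apply: contraR => /pred0Pn[x /andP[/= Ax Bx]].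
  by rewrite (even_class_pair DA Ax) -(even_class_pair DB Bx).
rewrite cover_even_classes; apply/subsetP => x /nonzero_squareP[w nz_w ->].
by rewrite !inE expf_neq0.
Qed.

Let tD : trivIset D.
Proof. by case: even_classes_disjoint_family. Qed.

(** A nonzero [z] arises only from [x = z / 2], hence once or never, according to whether [z / 2] is
    in [Q]. *)
Lemma count_internal_even_classes (z : F) :
  count_mem z (internal_differences D) = (z != 0) && ((z \in Q) (+) odd e./2).
Proof.
have [-> | nz_z] := eqVneq z 0; first exact: count0_internal_differences.
rewrite (count_internal_pairs tD even_class_pair nz_z) cover_even_classes.
have Dz : z = (z / 2%:R) *+ 2.
  by rewrite -mulr_natr divfK // primitive_element_odd_char.
have nz_z2 : z / 2%:R != 0.
  by rewrite mulf_neq0 ?invr_eq0 ?primitive_element_odd_char.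
rewrite [in RHS]Dz double_nonzero_square // addbK -sum_eq_mem.
apply: eq_bigr => x _; congr nat_of_bool.
rewrite {1}Dz -subr_eq0 -mulrnBl -[(_ - x) *+ 2]mulr_natr mulf_eq0.
by rewrite (negPf primitive_element_odd_char) orbF subr_eq0 eq_sym.
Qed.

(** Scaling by 4 and moving all terms to one side avoids division and truncated subtraction in
    [nat]. *)
Lemma count_external_even_classes (z : F) :
  (4 * count_mem z (external_differences D)
     + 4 * ((z != 0%R) && ((z \in Q) (+) odd e./2)) + 4 * (z \in Q)
   = (z != 0%R) * (e * 2))%N.
Proof.
have [-> | nz_z] := eqVneq z 0.
  rewrite count0_external_differences //=; case: nonzero_squareP => //.
  by case=> w nz_w /esym/eqP; rewrite expf_eq0 (negPf nz_w).
have := count_internal_external tD nz_z.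
rewrite count_internal_even_classes nz_z cover_even_classes.
have := sum_nonzero_squares_shift primitive_element_odd_char nz_z
  oppr1_nonzero_square.
rewrite card1F; set n := (\sum_(_ in _) _)%N.
by rewrite /= mul1n => <- <-; rewrite mulnDr; congr addn; rewrite addnC.
Qed.

End EvenClasses.

Theorem theorem5p13 (F : finFieldType) (alpha : F) (q e f : nat)
    (cardF : #|F| = q) (alpha_prim : primitive_element alpha)
    (q_def : q = e * f + 1) (q_mod4 : q = 1 %[mod 4])
    (e_even : ~~ odd e) (f_def : f = 2) :
  (q = 1 %[mod 8] ->
     disjoint_partial_difference_family q ((q - 1) %/ 4) 2 1 0
       (even_classes alpha e) /\
     external_partial_difference_family q ((q - 1) %/ 4) 2
       ((q - 9) %/ 4) ((q - 1) %/ 4) (even_classes alpha e)) /\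
  (q = 5 %[mod 8] ->
     disjoint_partial_difference_family q ((q - 1) %/ 4) 2 0 1
       (even_classes alpha e) /\
     external_difference_family q ((q - 1) %/ 4) 2 ((q - 5) %/ 4)
       (even_classes alpha e)).
Proof.
subst f; rewrite q_def in cardF q_mod4 *.
have fam := even_classes_disjoint_family cardF alpha_prim e_even.
have cntI := count_internal_even_classes cardF alpha_prim e_even.
have cntE := count_external_even_classes cardF alpha_prim e_even.
have covE := cover_even_classes cardF alpha_prim e_even.
have mE : (e * 2 + 1 - 1) %/ 4 = e./2 by lia.
have Q0 (z : F) : z \in nonzero_squares F -> z != 0%R.
  by case/nonzero_squareP=> w nz_w ->; rewrite expf_neq0.
(* Since [q - 1 = 4 * e./2], the residue of [q] modulo 8 decides the parity of [e./2]. *)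
have parity_half b : (e * 2 + 1) %% 8 = (if b then 5 else 1) -> odd e./2 = b.
  by case: b; lia.
have permI (s t : seq F) :
    (forall z, count_mem z s = count_mem z t) -> perm_eq s t.
  by move=> eq_st; apply/allP => z _; apply/eqP/eq_st.
have copiesE l m (z : F) :
    count_mem z (copies l (nonzero_squares F)
      ++ copies m ([set~ 0%R] :\: nonzero_squares F))
    = l * (z \in nonzero_squares F)
      + m * ((z \notin nonzero_squares F) && (z != 0%R)).
  by rewrite count_cat !count_copies in_setD in_setC1.
rewrite mE; split=> [/(parity_half false) | /(parity_half true)] oddh;
  rewrite oddh in cntI cntE; split; split=> //; apply: permI => z;
  (* Multiplicities are compared separately for [z] zero, in [Q], or a nonsquare; [Q0] excludes a
     zero [z] in [Q]. *)
  rewrite ?covE ?copiesE ?count_copies ?in_setC1; have := Q0 z; have := cntE z;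
  rewrite ?cntI; case: (z \in _); case: (z == 0%R) => /=; lia.
Qed.
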